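(* Let $\varphi,u_1,u_2:\mathbb R_+^2\to\mathbb R_+$ each satisfy properties (I)–(IV) listed in the context. Starting from an interior market state $\mathbf R^{\mathsf{in}}$, suppose that the two agents take turns trading with the CFMM and that each active agent makes the utility-maximizing trade for herself. Then the limiting market state of the resulting infinite sequence is a unilateral equilibrium. Moreover, this limit belongs to $\mathcal U(\mathbf R^{\mathsf{in}})$ and is Pareto optimal.
   Context: Notation: $\mathbb R_+=[0,\infty)$, $\mathbb R_{++}=(0,\infty)$. For a function $u$ that is differentiable with nonzero partial derivatives at $(x,y)$, put $p(u,x,y):=\partial_xu(x,y)/\partial_yu(x,y)$. Properties of a function $u:\mathbb R_+^2\to\mathbb R_+$: (I) $u$ is continuous, $u(x,0)=u(0,y)=0$ for all $x,y\in\mathbb R_+$, and $u$ is strictly increasing (in each coordinate) on $\mathbb R_{++}^2$. (II) $\lim_{x'\to\infty}u(x',y)=\infty$ and $\lim_{y'\to\infty}u(x,y')=\infty$ for every $x,y>0$. (III) $u$ is continuously differentiable and strictly concave on $\mathbb R_{++}^2$. (IV) For any $x_1,x_2,y_1,y_2\in\mathbb R_{++}$ with $x_1\le x_2$ and $y_1\ge y_2$, at least one inequality strict, $p(u,x_1,y_1)>p(u,x_2,y_2)$ whenever the prices are defined. Market: there is one constant-function market maker (CFMM) with trading function $\varphi$ and two agents with utilities $u_1,u_2$. A market state is $\mathbf R=(\mathbf r_0,\mathbf r_1,\mathbf r_2)\in(\mathbb R_+^2)^3$ ($\mathbf r_0$ = CFMM inventory, $\mathbf r_i$ = holding of agent $i$);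 it is interior if it lies in $(\mathbb R_{++}^2)^3$. $\mathcal F(\mathbf R^{\mathsf{in}})$ is the set of market states $\mathbf R$ with $\mathbf r_0+\mathbf r_1+\mathbf r_2=\mathbf r_0^{\mathsf{in}}+\mathbf r_1^{\mathsf{in}}+\mathbf r_2^{\mathsf{in}}$ and $\varphi(\mathbf r_0)=\varphi(\mathbf r_0^{\mathsf{in}})$, and $\mathcal U(\mathbf R^{\mathsf{in}})=\{\mathbf R\in\mathcal F(\mathbf R^{\mathsf{in}}):u_i(\mathbf r_i)\ge u_i(\mathbf r_i^{\mathsf{in}}),\ i=1,2\}$. A trade $\mathbf h\in\mathbb R^2$ is valid for $\mathbf R$ and agent $i\in\{1,2\}$ if $\mathbf r_0+\mathbf h\in\mathbb R_+^2$, $\varphi(\mathbf r_0+\mathbf h)=\varphi(\mathbf r_0)$ and $\mathbf r_i-\mathbf h\in\mathbb R_+^2$; executing it replaces $\mathbf r_0$ by $\mathbf r_0+\mathbf h$, $\mathbf r_i$ by $\mathbf r_i-\mathbf h$, and leaves the other holding unchanged. A market state is a unilateral equilibrium if for each agent $i$ there is no valid trade $\mathbf h$ with $u_i(\mathbf r_i-\mathbf h)>u_i(\mathbf r_i)$. A market state $\mathbf R^*$ is Pareto optimal if there is no $\mathbf R\in\mathcal F(\mathbf R^* )$ with $u_i(\mathbf r_i)\ge u_i(\mathbf r_i^* )$ for $i=1,2$ and strict inequality for at least one $i$. The utility-maximizing trade of agent $i$ at an interior state is the (unique, under (I)–(IV)) valid trade $\mathbf h$ maximizing $u_i(\mathbf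 r_i-\mathbf h)$. ''Taking turns'' means that the agents alternate strictly, one trade each; either agent may go first. Under the stated hypotheses the infinite sequence of market states converges; the limiting market state is its limit. *)

(* Defs.v *)
From HB Require Import structures.
From mathcomp Require Import all_boot all_order all_algebra.
From mathcomp Require Import all_classical all_reals all_analysis.

Set Implicit Arguments.
Unset Strict Implicit.
Unset Printing Implicit Defensive.

Import Order.TTheory GRing.Theory Num.Theory.
Import numFieldNormedType.Exports.

Local Open Scope classical_set_scope.
Local Open Scope ring_scope.

Section TradingFunctions.
Context {R : realType}.

Definition quadrant : set (R * R) := [set z | 0 <= z.1 /\ 0 <= z.2].
Definition open_quadrant : set (R * R) := [set z | 0 < z.1 /\ 0 < z.2].

(* A function R_+^2 -> R_+ is encoded as a function on R * R; only its values
   on [quadrant] matter. *)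
Implicit Types (u phi : R * R -> R) (h z : R * R).

Definition partial_x u z : R := 'D_(1, 0) u z.
Definition partial_y u z : R := 'D_(0, 1) u z.

Definition price u z : R := partial_x u z / partial_y u z.

Definition price_defined u z : Prop :=
  [/\ differentiable u z, partial_x u z <> 0 & partial_y u z <> 0].

Definition nonneg_valued u : Prop := forall z, quadrant z -> 0 <= u z.

Definition propertyI u : Prop :=
  [/\ {within quadrant, continuous u},
      forall x : R, 0 <= x -> u (x, 0) = 0,
      forall y : R, 0 <= y -> u (0, y) = 0,
      forall x x' y : R, 0 < x -> x < x' -> 0 < y -> u (x, y) < u (x', y)
    & forall x y y' : R, 0 < x -> 0 < y -> y < y' -> u (x, y) < u (x, y')].

Definition propertyII u : Prop :=
  forall x y : R, 0 < x -> 0 < y ->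
    (u (x', y) @[x' --> +oo] --> +oo) /\ (u (x, y') @[y' --> +oo] --> +oo).

Definition continuously_differentiable_on (A : set (R * R)) u : Prop :=
  forall z, A z ->
    [/\ differentiable u z, {for z, continuous (partial_x u)}
      & {for z, continuous (partial_y u)}].

Definition strictly_concave_on (A : set (R * R)) u : Prop :=
  forall z w (t : R), A z -> A w -> z <> w -> 0 < t < 1 ->
    t * u z + (1 - t) * u w < u (t *: z + (1 - t) *: w).

Definition propertyIII u : Prop :=
  continuously_differentiable_on open_quadrant u /\
  strictly_concave_on open_quadrant u.

Definition propertyIV u : Prop :=
  forall x1 x2 y1 y2 : R, 0 < x1 -> 0 < x2 -> 0 < y1 -> 0 < y2 ->
    x1 <= x2 -> y2 <= y1 -> x1 < x2 \/ y2 < y1 ->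
    price_defined u (x1, y1) -> price_defined u (x2, y2) ->
    price u (x2, y2) < price u (x1, y1).

Definition properties_I_IV u : Prop :=
  [/\ nonneg_valued u, propertyI u, propertyII u, propertyIII u & propertyIV u].

End TradingFunctions.

Variant agent := agent1 | agent2.

Definition other (i : agent) : agent :=
  match i with agent1 => agent2 | agent2 => agent1 end.

Section Market.
Context {R : realType}.

(* (r0, r1, r2): the inventory of the CFMM, then the holdings of the agents. *)
Definition state : Type := ((R * R) * (R * R) * (R * R))%type.

Implicit Types (S T : state) (i : agent) (h : R * R).
Implicit Types (phi u : R * R -> R).

Definition inventory S : R * R := S.1.1.

Definition holding S i : R * R :=
  match i with agent1 => S.1.2 | agent2 => S.2 end.

Definition utility u1 u2 i : R * R -> R :=
  match i with agent1 => u1 | agent2 => u2 end.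

Definition market_state S : Prop :=
  quadrant (inventory S) /\ forall i, quadrant (holding S i).

Definition interior_state S : Prop :=
  open_quadrant (inventory S) /\ forall i, open_quadrant (holding S i).

Definition total S : R * R :=
  inventory S + holding S agent1 + holding S agent2.

Definition feasible phi S : set state :=
  [set T | [/\ market_state T, total T = total S
             & phi (inventory T) = phi (inventory S)]].

Definition feasible_improving phi u1 u2 S : set state :=
  [set T | feasible phi S T /\
     forall i, utility u1 u2 i (holding S i) <= utility u1 u2 i (holding T i)].

Definition valid_trade phi S i h : Prop :=
  [/\ quadrant (inventory S + h),
      phi (inventory S + h) = phi (inventory S)
    & quadrant (holding S i - h)].

Definition execute S i h : state :=
  match i with
  | agent1 => (inventory S + h, holding S agent1 - h, holding S agent2)
  | agent2 => (inventory S + h, holding S agent1, holding S agent2 - h)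
  end.

Definition unilateral_equilibrium phi u1 u2 S : Prop :=
  market_state S /\
  forall i, ~ exists h, valid_trade phi S i h /\
    utility u1 u2 i (holding S i) < utility u1 u2 i (holding S i - h).

Definition pareto_optimal phi u1 u2 S : Prop :=
  market_state S /\
  ~ exists T, [/\ feasible phi S T,
      forall i, utility u1 u2 i (holding S i) <= utility u1 u2 i (holding T i)
    & exists i, utility u1 u2 i (holding S i) < utility u1 u2 i (holding T i)].

Definition utility_maximizing_trade phi u1 u2 S i h : Prop :=
  valid_trade phi S i h /\
  forall h', valid_trade phi S i h' ->
    utility u1 u2 i (holding S i - h') <= utility u1 u2 i (holding S i - h).

Definition active (first : agent) (n : nat) : agent := iter n other first.

Definition taking_turns phi u1 u2 (first : agent) (Sin : state)
    (S : nat -> state) : Prop :=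
  S 0%N = Sin /\
  forall n, exists h,
    utility_maximizing_trade phi u1 u2 (S n) (active first n) h /\
    S n.+1 = execute (S n) (active first n) h.

End Market.
Arguments state : clear implicits.

(* Main.v *)
(* Both utilities are nondecreasing along the play, hence converge, and by
   continuity each cluster point of the play is a unilateral equilibrium at
   which the two agents have the limiting utilities. At an interior equilibrium
   r the differential of phi at r0 supports, strictly, the level set of phi
   through r0 and the upper level sets of both u_i through r_i; since the total
   holdings are conserved, no other feasible state gives both agents at least
   the same utilities. Hence the cluster point is unique, so the play converges
   to it, and it is Pareto optimal. *)

Require Import Defs.
From HB Require Import structures.
From mathcomp Require Import all_boot all_order all_algebra.
From mathcomp Require Import all_classical all_reals all_analysis.
From mathcomp Require Import lra.

Set Implicit Arguments.
Unset Strict Implicit.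
Unset Printing Implicit Defensive.

Import Order.TTheory GRing.Theory Num.Theory.
Import numFieldNormedType.Exports.

Local Open Scope classical_set_scope.
Local Open Scope ring_scope.

(** * Cluster points and convergence *)

(** If [F] did not contain a neighbourhood [U] of [x], then restricting [F] to the complement of [U]
    would give a proper filter. By compactness that filter clusters somewhere in [V]. Its cluster
    points are cluster points of [F], hence equal to [x], which [U] excludes. *)
Lemma compact_unique_cluster_cvg (T : topologicalType) (F : set_system T)
    (V : set T) (x : T) : ProperFilter F ->
  compact V -> F V -> cluster F `<=` [set x] -> F --> x.
Proof.
move=> FF cV FV Fx U Ux; apply: contrapT => nFU.
have GF : ProperFilter (within (~` U) F).
  split; last exact: within_filter.
  rewrite /within /= => FU; apply: nFU; apply: filterS FU => t nUt.
  by apply: contrapT => /nUt.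
have subF A : F A -> within (~` U) F A by apply: filterS.
have [y [_ Gy]] := cV _ GF (subF _ FV).
have yx : y = x by apply: Fx => A B FA By; exact: Gy (subF _ FA) By.
rewrite yx in Gy.
by have [t []] := Gy (~` U) U (withinT _ _) Ux.
Qed.

Lemma cluster_closed (T : topologicalType) (F : set_system T) (A : set T) x :
  closed A -> F A -> cluster F x -> A x.
Proof. by move=> cA FA Fx; apply: cA => B Bx; exact: Fx. Qed.

(** Neighbourhoods of [f x] and of [l] always meet: [X] is frequently close to [x], while [f (X n)]
    is eventually close to [l]. *)
Lemma cluster_continuous_cvg (I : Type) (T W : topologicalType)
    (F : set_system I) (X : I -> T) (f : T -> W) (x : T) (l : W) :
  hausdorff_space W -> cluster (X @ F) x -> {for x, continuous f} ->
  f (X n) @[n --> F] --> l -> f x = l.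
Proof.
move=> hW Fx fx fl; apply: hW => A B Ax Bl.
by have [t [Bt At]] := Fx (f @^-1` B) _ (fl _ Bl) (fx _ Ax); exists (f t).
Qed.

(** * Trading functions: continuity, positivity and monotonicity on the quadrant *)

Section TradingFunctionTheory.
Context {R : realType}.
Implicit Types (u : R * R -> R) (z w v : R * R).

(* Precomposition with this retraction turns continuity on the quadrant into
   continuity on the whole plane. *)
Definition clamp z : R * R := (Num.max z.1 0, Num.max z.2 0).

Lemma clamp_quadrant z : quadrant (clamp z).
Proof. by split; rewrite /= le_max lexx orbT. Qed.

Lemma clamp_id z : quadrant z -> clamp z = z.
Proof. by case: z => x y [/= x0 y0]; rewrite /clamp /= !max_l. Qed.

Lemma clamp_continuous : continuous clamp.
Proof.
move=> z.
have c1 : {for z, continuous (fun w : R * R => Num.max w.1 0 : R)}.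
  by apply: continuous_max; [exact: cvg_fst|exact: cvg_cst].
have c2 : {for z, continuous (fun w : R * R => Num.max w.2 0 : R)}.
  by apply: continuous_max; [exact: cvg_snd|exact: cvg_cst].
exact: cvg_pair c1 c2.
Qed.

Lemma comp_clamp_continuous u :
  {within quadrant, continuous u} -> continuous (u \o clamp).
Proof.
move=> /subspace_continuousP uc z.
have cz : clamp w @[w --> z] --> within quadrant (nbhs (clamp z)).
  move=> A /clamp_continuous Az.
  have : nbhs z (clamp @^-1` [set w | quadrant w -> A w]) by exact: Az.
  apply: (@filterS _ (nbhs z)) => w Aw; exact: Aw (clamp_quadrant w).
exact: cvg_comp cz (uc _ (clamp_quadrant z)).
Qed.

Lemma open_quadrant_quadrant z : open_quadrant z -> quadrant z.
Proof. by move=> [? ?]; split; exact: ltW. Qed.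

Lemma open_open_quadrant : open (@open_quadrant R).
Proof.
have -> : @open_quadrant R =
    fst @^-1` [set x | 0 < x] `&` snd @^-1` [set x | 0 < x] by [].
apply: openI; apply: open_comp; try exact: open_gt.
- by move=> z _; exact: cvg_fst.
- by move=> z _; exact: cvg_snd.
Qed.

Lemma closed_quadrant : closed (@quadrant R).
Proof.
have -> : @quadrant R =
    fst @^-1` [set x | 0 <= x] `&` snd @^-1` [set x | 0 <= x] by [].
apply: closedI; apply: preimage_closed; try exact: closed_ge.
- by move=> z _; exact: cvg_fst.
- by move=> z _; exact: cvg_snd.
Qed.

Lemma quadrantD z w : quadrant z -> quadrant w -> quadrant (z + w).
Proof. by move=> [? ?] [? ?]; split; rewrite addr_ge0. Qed.

Lemma quadrantZ (t : R) z : 0 <= t -> quadrant z -> quadrant (t *: z).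
Proof. by move=> t0 [? ?]; split; rewrite mulr_ge0. Qed.

Lemma trading_gt0 u z : properties_I_IV u -> open_quadrant z -> 0 < u z.
Proof.
move=> [u0 [_ _ _ ux _] _ _ _]; case: z => x y [/= x0 y0].
have x20 : 0 < x / 2 by rewrite divr_gt0.
apply: le_lt_trans (ux (x / 2) x y x20 _ y0); last by lra.
by apply: u0; split => /=; exact: ltW.
Qed.

(** Trading functions vanish on the axes. This is how interiority is recovered from bounds on
    utilities and on [phi]. *)
Lemma trading_gt0_open u z :
  properties_I_IV u -> quadrant z -> 0 < u z -> open_quadrant z.
Proof.
move=> [_ [_ ux uy _ _] _ _ _]; case: z => x y [/=].
rewrite !le_eqVlt => /predU1P[<-|x0] /predU1P[<-|y0];
  rewrite ?ux ?uy ?ltxx //; first exact: ltW.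
exact: ltW.
Qed.

(** Strict monotonicity is given on the open quadrant only. A point [z] on an axis has value 0, and
    otherwise the coordinates are raised one at a time. *)
Lemma trading_le u z w : properties_I_IV u -> quadrant z ->
  quadrant (w - z) -> u z <= u w.
Proof.
move=> uP zq; case: (uP) => u0 [_ uX uY ux uy] _ _ _.
case: z w zq => [x y] [x' y'] [/= x0 y0] [/=]; rewrite !subr_ge0.
move: x0; rewrite le_eqVlt => /predU1P[<-|x0] xx' yy'.
  by rewrite uY//; apply: u0; split => //=; exact: le_trans yy'.
move: y0; rewrite le_eqVlt => /predU1P[y0|y0].
  rewrite -y0 (uX _ (ltW x0)); apply: u0; split => /=; last by rewrite y0.
  exact: le_trans (ltW x0) xx'.
apply: (@le_trans _ _ (u (x', y))).
  move: xx'; rewrite le_eqVlt => /predU1P[->//|xx'].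
  by rewrite ltW// ux.
move: yy'; rewrite le_eqVlt => /predU1P[->//|yy'].
by rewrite ltW// uy// (lt_le_trans x0).
Qed.

(** Intermediate value theorem along the segment from the origin, where [u] is 0, to [w]. *)
Lemma trading_scaling_eq u w (c : R) : properties_I_IV u -> quadrant w ->
  0 <= c <= u w -> exists2 t : R, 0 <= t <= 1 & u (t *: w) = c.
Proof.
move=> [_ [uc uX _ _ _] _ _ _] wq /andP[c0 cw].
pose f (t : R) := u (clamp (t *: w)).
have fE t : 0 <= t -> f t = u (t *: w).
  by move=> t0; rewrite /f clamp_id//; exact: quadrantZ.
have f0 : f 0 = 0 by rewrite fE// scale0r uX.
have f1 : f 1 = u w by rewrite fE// scale1r.
have fc : {within `[0, 1], continuous f}.
  apply: continuous_subspaceT => t.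
  apply: (@continuous_comp _ _ _ (fun t : R => t *: w) (u \o clamp)).
    by apply: cvgZr_tmp; exact: cvg_id.
  exact: comp_clamp_continuous.
have w0 : 0 <= u w by exact: le_trans cw.
have [|t] := IVT (v := c) ler01 fc.
  by rewrite f0 f1 min_l// max_r// c0 cw.
rewrite in_itv /= => t01 ftc; exists t => //; rewrite -fE//.
by case/andP: t01.
Qed.

(** * Differentials of strictly concave functions *)

Lemma derive_right_cvg u z v : differentiable u z ->
  h^-1 * (u (z + h *: v) - u z) @[h --> 0^'+] --> 'd u z v.
Proof.
move=> du; rewrite -deriveE//.
have dz : h^-1 *: (u (h *: v + z) - u z) @[h --> 0^'] --> 'D_v u z.
  exact: diff_derivable.
move=> A /dz Az.
have {}Az : \forall h \near (0 : R)^', A (h^-1 *: (u (h *: v + z) - u z)) by [].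
apply: (@filterS _ (nbhs (0 : R)) _ _ _ _ Az) => h Ah h0.
by rewrite /= [z + _]addrC; apply: Ah; rewrite gt_eqF.
Qed.

(** By concavity every difference quotient at [z] towards [w] with step in (0, 1) is at least
    [u w - u z]; the step then tends to 0 from the right. *)
Lemma concave_le_diff u z w :
  differentiable u z -> strictly_concave_on open_quadrant u ->
  open_quadrant z -> open_quadrant w -> u w - u z <= 'd u z (w - z).
Proof.
move=> du uc zq wq; have [->|zw] := eqVneq w z.
  by rewrite !subrr linear0.
have dz := derive_right_cvg (v := w - z) du.
refine (ler_cvg_to (f := fun _ : R => u w - u z) (cvg_cst _) dz _).
near=> h.
have h0 : 0 < h by near: h; exact: nbhs_right_gt.
have h1 : h < 1 by near: h; exact: nbhs_right_lt.
have := uc w z h wq zq (elimN eqP zw); rewrite h0 h1 => /(_ isT) uh.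
rewrite ler_pdivlMl//.
have -> : z + h *: (w - z) = h *: w + (1 - h) *: z.
  by rewrite scalerBr scalerBl scale1r addrCA addrA.
lra.
Unshelve. all: by end_near. Qed.

Lemma open_quadrant_convex z w (t : R) : open_quadrant z -> open_quadrant w ->
  0 < t < 1 -> open_quadrant (t *: z + (1 - t) *: w).
Proof.
move=> [z1 z2] [w1 w2] /andP[t0 t1].
by split; rewrite addr_gt0// mulr_gt0// subr_gt0.
Qed.

(** The tangent inequality at [w] itself gives only a weak sign. At the midpoint of [z] and [w],
    strict concavity has already raised [u] above [u z]. *)
Lemma level_diff_gt0 u z w :
  differentiable u z -> strictly_concave_on open_quadrant u ->
  open_quadrant z -> open_quadrant w -> u z <= u w -> z <> w ->
  0 < 'd u z (w - z).
Proof.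
move=> du uc zq wq uzw zw.
have half01 : 0 < (2^-1 : R) < 1 by lra.
pose m := 2^-1 *: w + (1 - 2^-1) *: z.
have um : u z < u m.
  by have := uc w z 2^-1 wq zq (nesym zw) half01; rewrite -/m; lra.
have := concave_le_diff du uc zq (open_quadrant_convex wq zq half01).
rewrite -/m.
have -> : m - z = 2^-1 *: (w - z).
  by rewrite /m scalerBl scale1r addrA addrAC addrK scalerBr.
rewrite linearZ => mz.
have : 0 < 2^-1 * 'd u z (w - z) by apply: lt_le_trans mz; rewrite subr_gt0.
by rewrite pmulr_rgt0// invr_gt0.
Qed.
Lemma trading_comp_clamp_continuous u :
  properties_I_IV u -> continuous (u \o clamp).
Proof. by move=> [_ [uc _ _ _ _] _ _ _]; exact: comp_clamp_continuous. Qed.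

Lemma trading_differentiable u z :
  properties_I_IV u -> open_quadrant z -> differentiable u z.
Proof. by move=> [_ _ _ [ud _] _] /ud[]. Qed.

Lemma trading_concave u :
  properties_I_IV u -> strictly_concave_on open_quadrant u.
Proof. by case=> _ _ _ []. Qed.

(** * Small moves from an interior point *)

Lemma near0_at_right (P : R -> Prop) :
  (\forall h \near (0 : R), P h) -> \forall h \near 0^'+, P h.
Proof. by move=> [e e0 eP]; exists e => // h he _; exact: eP. Qed.

Lemma translate_cvg z v : z + h *: v @[h --> (0 : R)] --> z.
Proof.
have : z + h *: v @[h --> (0 : R)] --> z + 0 *: v.
  by apply: cvgD; [exact: cvg_cst|apply: cvgZr_tmp; exact: cvg_id].
by rewrite scale0r addr0.
Qed.

Lemma open_quadrant_near_translate z v :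
  open_quadrant z -> \forall h \near 0^'+, open_quadrant (z + h *: v).
Proof.
move=> zq.
have /(translate_cvg v) zn : nbhs z open_quadrant.
  by apply: open_nbhs_nbhs; split; [exact: open_open_quadrant|].
apply: (near0_at_right (P := fun h => open_quadrant (z + h *: v))).
exact: zn.
Qed.

Lemma trading_lower_direction u z (c : R) : properties_I_IV u ->
  open_quadrant z -> c < u z ->
  \forall e \near 0^'+, open_quadrant (z + e *: (-1, -1)) /\
    c < u (z + e *: (-1, -1)).
Proof.
move=> uP zq cz; near=> e; split.
  by near: e; exact: open_quadrant_near_translate.
have -> : z + e *: (-1, -1) = clamp (z + e *: (-1, -1)).
  rewrite clamp_id//; apply: open_quadrant_quadrant.
  by near: e; exact: open_quadrant_near_translate.
near: e.
have gc : (u \o clamp) (z + e *: (-1, -1)) @[e --> (0 : R)] --> (u \o clamp) z.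
  exact: cvg_comp (translate_cvg _) (@trading_comp_clamp_continuous _ uP z).
have cz' : c < (u \o clamp) z.
  by rewrite /= clamp_id//; exact: open_quadrant_quadrant.
have zn := cvgr_gt _ gc _ cz'.
apply: (near0_at_right (P := fun e => c < (u \o clamp) (z + e *: (-1, -1)))).
exact: zn.
Unshelve. all: by end_near. Qed.

Lemma near_right_diff_gt0 u z v : differentiable u z -> 0 < 'd u z v ->
  \forall h \near 0^'+, u z < u (z + h *: v).
Proof.
move=> du dv; near=> h.
have h0 : 0 < h by near: h; exact: nbhs_right_gt.
have : 0 < h^-1 * (u (z + h *: v) - u z).
  by near: h; exact: cvgr_gt (derive_right_cvg du) _ dv.
by rewrite pmulr_rgt0 ?invr_gt0// subr_gt0.
Unshelve. all: by end_near. Qed.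

End TradingFunctionTheory.

(** * Market states and the execution of trades *)

Section MarketTheory.
Context {R : realType}.
Implicit Types (phi u : R * R -> R) (S T : state R) (i : agent) (h w : R * R).

Lemma quadrant0 : quadrant (0 : R * R).
Proof. by split; rewrite /= lexx. Qed.

Lemma utility_properties u1 u2 i :
  properties_I_IV u1 -> properties_I_IV u2 -> properties_I_IV (utility u1 u2 i).
Proof. by case: i. Qed.

Lemma inventory_execute S i h : inventory (execute S i h) = inventory S + h.
Proof. by case: i. Qed.

Lemma holding_execute S i h : holding (execute S i h) i = holding S i - h.
Proof. by case: i. Qed.

Lemma holding_execute_other S i h :
  holding (execute S i h) (other i) = holding S (other i).
Proof. by case: i. Qed.

Lemma agent_other i j : j = i \/ j = other i.
Proof. by case: i; case: j; [left|right|right|left]. Qed.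

Lemma totalE S i :
  Defs.total S = inventory S + holding S i + holding S (other i).
Proof. by case: i => //; rewrite /Defs.total addrAC. Qed.

Lemma total_execute S i h : Defs.total (execute S i h) = Defs.total S.
Proof.
rewrite !(totalE _ i) inventory_execute holding_execute holding_execute_other.
by rewrite addrACA subrr addr0.
Qed.

Lemma market_state_execute phi S i h :
  market_state S -> valid_trade phi S i h -> market_state (execute S i h).
Proof.
move=> [_ Sq] [iq _ hq]; split=> [|j]; first by rewrite inventory_execute.
by have [->|->] := agent_other i j;
  rewrite ?holding_execute ?holding_execute_other.
Qed.

(** * Equilibria: supporting differential and unimprovability *)

(** A trade is described by the inventory [w] it leads to; the agent keeps the rest of the resources
    she shares with the CFMM. *)
Lemma valid_trade_to phi S i w :
  quadrant w -> phi w = phi (inventory S) ->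
  quadrant (inventory S + holding S i - w) ->
  valid_trade phi S i (w - inventory S).
Proof.
move=> wq phiw Aq.
by split; rewrite ?subrKC// opprB addrA [_ + inventory S]addrC.
Qed.

(* Otherwise the midpoint m of z and r_i, lowered to m' along the diagonal, is
   still better than r_i and 'd phi (r_i - m') > 0: a short step towards m' then
   raises phi above its level, and scaling the inventory back to that level
   gives agent i a profitable valid trade. *)
Lemma equilibrium_support phi u1 u2 S i z :
  properties_I_IV phi -> properties_I_IV u1 -> properties_I_IV u2 ->
  unilateral_equilibrium phi u1 u2 S -> interior_state S -> quadrant z ->
  utility u1 u2 i (holding S i) <= utility u1 u2 i z -> holding S i <> z ->
  0 < 'd phi (inventory S) (z - holding S i).
Proof.
move=> phiP u1P u2P [_ Seq] [r0q rq] zq uz rz.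
have uP := utility_properties i u1P u2P.
move: (Seq i) (rq i) => {}Seq {}rq.
set r0 := inventory S in r0q *; set r := holding S i in rq uz rz *.
move: (utility u1 u2 i) uP uz Seq => u uP uz Seq.
rewrite ltNge; apply/negP => dz.
have {}zq : open_quadrant z.
  apply: (trading_gt0_open uP zq); apply: lt_le_trans uz.
  exact: trading_gt0.
have half01 : 0 < (2^-1 : R) < 1 by lra.
pose m := 2^-1 *: z + (1 - 2^-1) *: r.
have mq : open_quadrant m by exact: open_quadrant_convex.
have um : u r < u m.
  by have := trading_concave uP zq rq (nesym rz) half01; rewrite -/m; lra.
have mr : m - r = 2^-1 *: (z - r).
  by rewrite /m scalerBl scale1r addrA addrAC addrK scalerBr.
have dphi := trading_differentiable phiP r0q.
pose down : R * R := (-1, -1).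
(* Tangent inequality at [r0] towards [r0 - down], which adds 1 to both coordinates and so raises
   [phi]. *)
have ddown : 'd phi r0 down < 0.
  have r1q : open_quadrant (r0 - down).
    by case: r0q => r01 r02; split; rewrite /= opprK addr_gt0.
  have : phi r0 < phi (r0 - down).
    case: (r0) r0q => x y [/= x0 y0]; case: (phiP) => _ [_ _ _ phix phiy] _ _ _.
    apply: (@lt_trans _ _ (phi (x + 1, y))); first by rewrite phix// ltrDl.
    have -> : (x, y) - down = (x + 1, y + 1).
      by rewrite /down; congr pair; rewrite /= opprK.
    by rewrite phiy ?ltrDl// addr_gt0.
  have := concave_le_diff dphi (trading_concave phiP) r0q r1q.
  rewrite addrAC subrr add0r linearN -subr_gt0.
  by move=> /[swap] /lt_le_trans/[apply]; rewrite oppr_gt0.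
have [e [mq' um'] e0] : exists2 e : R, open_quadrant (m + e *: down) /\
    u r < u (m + e *: down) & 0 < e.
  near (0 : R)^'+ => e; exists e.
    by near: e; exact: trading_lower_direction.
  by near: e; exact: nbhs_right_gt.
set m' := m + e *: down in mq' um'.
(* The part along [z - r] contributes at least 0 by the assumption to be refuted; the lowering by
   [e] makes the sum strictly positive. *)
have dd : 0 < 'd phi r0 (r - m').
  have -> : r - m' = - (2^-1 *: (z - r)) - e *: down.
    by rewrite -mr opprB /m' opprD addrA.
  rewrite linearB linearN !linearZ /=.
  have : 0 < e * - 'd phi r0 down by rewrite mulr_gt0// oppr_gt0.
  have : 0 <= 2^-1 * - 'd phi r0 (z - r) by rewrite mulr_ge0// oppr_ge0.
  by rewrite !mulrN /GRing.scale /=; lra.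
have [s [s01 phis vq]] : exists s : R, [/\ 0 < s < 1,
    phi r0 < phi (r0 + s *: (r - m')) & open_quadrant (r0 + s *: (r - m'))].
  near (0 : R)^'+ => s; exists s; split.
  - apply/andP; split; near: s; [exact: nbhs_right_gt|exact: nbhs_right_lt].
  - by near: s; exact: near_right_diff_gt0.
  - by near: s; exact: open_quadrant_near_translate.
set v := r0 + _ in phis vq.
have [t /andP[t0 t1] phit] : exists2 t : R, 0 <= t <= 1 & phi (t *: v) = phi r0.
  apply: (trading_scaling_eq phiP (open_quadrant_quadrant vq)).
  by apply/andP; split; apply: ltW; [exact: (trading_gt0 phiP r0q)|exact: phis].
have q'q : open_quadrant (s *: m' + (1 - s) *: r).
  exact: open_quadrant_convex.
have AvE : r0 + r - v = s *: m' + (1 - s) *: r.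
  by rewrite /v [r0 + r]addrC addrKA scalerBr opprB addrCA scalerBl scale1r.
(* Scaling the inventory from [v] down to [t *: v] hands the surplus [(1 - t) *: v] to the agent,
   who loses nothing by it. *)
have AtE : r0 + r - t *: v = (r0 + r - v) + (1 - t) *: v.
  by rewrite scalerBl scale1r addrA subrK.
have tvq : quadrant ((1 - t) *: v).
  by apply: quadrantZ; [rewrite subr_ge0|exact: open_quadrant_quadrant].
have q'q' : quadrant (r0 + r - v) by rewrite AvE; exact: open_quadrant_quadrant.
apply: Seq; exists (t *: v - r0); split.
  apply: valid_trade_to; [|exact: phit|].
    by apply: quadrantZ => //; exact: open_quadrant_quadrant.
  by rewrite AtE; exact: quadrantD.
rewrite opprB addrA [_ + r0]addrC AtE.
apply: (@lt_le_trans _ _ (u (r0 + r - v))); last first.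
  by apply: trading_le => //; rewrite addrAC subrr add0r.
rewrite AvE; have m'r : m' <> r by move=> m'r; rewrite m'r ltxx in um'.
have := trading_concave uP mq' rq m'r s01; apply: le_lt_trans.
case/andP: s01 => s0 _.
have : 0 <= s * (u m' - u r) by rewrite mulr_ge0 ?ltW// subr_gt0.
lra.
Unshelve. all: by end_near. Qed.

(** The displacements of the inventory and of the two holdings sum to 0, and so do their images
    under the differential of [phi]. Each nonzero displacement has a strictly positive image, so all
    three vanish. *)
Lemma equilibrium_unimprovable phi u1 u2 S T :
  properties_I_IV phi -> properties_I_IV u1 -> properties_I_IV u2 ->
  unilateral_equilibrium phi u1 u2 S -> interior_state S ->
  feasible phi S T ->
  (forall i, utility u1 u2 i (holding S i) <= utility u1 u2 i (holding T i)) ->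
  T = S.
Proof.
move=> phiP u1P u2P Seq Sq [[Tq0 Tq] TS Tphi] uST.
have [S0q _] := Sq; have c0 := trading_gt0 phiP S0q.
pose d := 'd phi (inventory S).
have d0 : inventory T = inventory S \/ 0 < d (inventory T - inventory S).
  have [->|/eqP TS0] := eqVneq (inventory T) (inventory S); [by left|right].
  apply: level_diff_gt0 => //; last exact: nesym.
  - exact: trading_differentiable.
  - exact: trading_concave.
  - by apply: (trading_gt0_open phiP Tq0); rewrite Tphi.
  - by rewrite Tphi.
have di i : holding T i = holding S i \/ 0 < d (holding T i - holding S i).
  have [->|/eqP TSi] := eqVneq (holding T i) (holding S i); [by left|right].
  exact: (equilibrium_support phiP u1P u2P Seq Sq (Tq i) (uST i) (nesym TSi)).
have sum0 : (inventory T - inventory S) +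
    (holding T agent1 - holding S agent1) +
    (holding T agent2 - holding S agent2) = 0.
  rewrite [X in X + _]addrACA -opprD addrACA -opprD.
  by move: TS; rewrite /Defs.total => ->; rewrite subrr.
have : d (inventory T - inventory S) + d (holding T agent1 - holding S agent1) +
    d (holding T agent2 - holding S agent2) = 0.
  by rewrite -[RHS](linear0 ('d phi (inventory S))) -sum0 !linearD.
have dz : d 0 = 0 by exact: linear0.
clearbody d; move: dz d0 (di agent1) (di agent2).
move=> {di uST Tphi TS Tq0 Tq sum0 Seq Sq S0q c0} dz.
case: T => -[T0 T1] T2; case: S => -[S0 S1] S2 /=; rewrite /inventory /=.
by move=> [->|d0] [->|d1] [->|d2]; rewrite ?subrr ?dz// => sum0; exfalso; lra.
Qed.

(** * Existence of best responses and of the play *)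

Definition box (A : R * R) : set (R * R) := `[0, A.1] `*` `[0, A.2].

Lemma box_compact (A : R * R) : compact (box A).
Proof. by apply: compact_setX; exact: segment_compact. Qed.

Lemma boxP (A w : R * R) : box A w <-> quadrant w /\ quadrant (A - w).
Proof.
rewrite /box /quadrant /= !in_itv /= !subr_ge0.
by split=> [[/andP[-> ->] /andP[-> ->]]|[[-> ->] [-> ->]]].
Qed.

(** Extreme value theorem over the inventories [w] on the current level set of [phi] with both [w]
    and [A - w] in the quadrant. This set [K] is compact, and nonempty because of the zero trade. *)
Lemma utility_maximizing_trade_exists phi u1 u2 S i :
  properties_I_IV phi -> properties_I_IV u1 -> properties_I_IV u2 ->
  market_state S -> exists h, utility_maximizing_trade phi u1 u2 S i h.
Proof.
move=> phiP u1P u2P [r0q rq].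
have gc := trading_comp_clamp_continuous (utility_properties i u1P u2P).
rewrite /utility_maximizing_trade; move: (utility u1 u2 i) gc => u gc.
set A := inventory S + holding S i.
pose K := box A `&` (phi \o clamp) @^-1` [set phi (inventory S)].
have Kc : compact K.
  apply: compact_closedI; first exact: box_compact.
  apply: preimage_closed; last exact: closed_eq.
  by move=> z _; exact: trading_comp_clamp_continuous.
have K0 : K (inventory S).
  split; last by rewrite /= clamp_id.
  by apply/boxP; split=> //; rewrite /A addrAC subrr add0r.
have fc : continuous (fun w => (u \o clamp) (A - w)).
  move=> w.
  apply: (@cvg_comp _ _ _ (fun w => A - w) (u \o clamp)); last exact: gc.
  by apply: cvgB; [exact: cvg_cst|exact: cvg_id].
have [|w] := compact_EVT_max (ex_intro _ _ K0) Kc _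
  (f := fun w => (u \o clamp) (A - w)).
  exact: continuous_subspaceT.
rewrite inE => -[/boxP[wq Aw]]; rewrite /= clamp_id// => phiw wmax.
exists (w - inventory S).
have hAE w' : holding S i - (w' - inventory S) = A - w'.
  by rewrite opprB addrA [_ + inventory S]addrC.
split=> [|h [vq phiv hq]]; first exact: valid_trade_to.
have AhE : A - (inventory S + h) = holding S i - h.
  by rewrite /A [inventory S + holding S i]addrC addrKA.
have /wmax : inventory S + h \in K.
  rewrite inE; split; last by rewrite /= clamp_id.
  by apply/boxP; rewrite AhE.
rewrite AhE.
by rewrite hAE !clamp_id.
Qed.

Lemma taking_turns_exists phi u1 u2 first Sin :
  properties_I_IV phi -> properties_I_IV u1 -> properties_I_IV u2 ->
  market_state Sin -> exists X, taking_turns phi u1 u2 first Sin X.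
Proof.
move=> phiP u1P u2P Sin_ms.
have /choice[f fP] : forall Si : state R * agent, exists h, market_state Si.1 ->
    utility_maximizing_trade phi u1 u2 Si.1 Si.2 h.
  (* The trade 0 is a mere default outside market states, which the play never reaches. *)
  move=> [S i]; have [S_ms|nS] := pselect (market_state S); last by exists 0.
  have [h hP] := utility_maximizing_trade_exists i phiP u1P u2P S_ms.
  by exists h.
pose X := fix X n := if n is m.+1 then
  execute (X m) (active first m) (f (X m, active first m)) else Sin.
have X_ms n : market_state (X n).
  elim: n => //= n Xn; have [hv _] := fP (X n, active first n) Xn.
  exact: market_state_execute hv.
exists X; split=> // n; exists (f (X n, active first n)); split=> //.
exact: (fP (X n, active first n) (X_ms n)).
Qed.

(** * Invariants of the play and monotone utilities *)

Section Dynamics.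
Context (phi u1 u2 : R * R -> R) (first : agent) (Sin : state R)
  (X : nat -> state R).
Context (phiP : properties_I_IV phi) (u1P : properties_I_IV u1)
  (u2P : properties_I_IV u2) (Sin_int : interior_state Sin)
  (XP : taking_turns phi u1 u2 first Sin X).

Let U i n := utility u1 u2 i (holding (X n) i).
(** The resources shared by agent [i] and the CFMM. Her own trades leave them unchanged, and
    reaching the inventory [w] leaves her [A i S - w]. *)
Let A i S := inventory S + holding S i.

Lemma taking_turns_feasible n : feasible phi Sin (X n).
Proof.
case: XP => X0 XS; elim: n => [|n [Xms Xtot Xphi]].
  rewrite X0; split=> //; case: Sin_int => S0 S_; split=> [|i];
  exact: open_quadrant_quadrant.
have [h [[hv _] ->]] := XS n; split.
- exact: market_state_execute hv.
- by rewrite total_execute.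
- by case: hv => _ + _; rewrite inventory_execute => ->.
Qed.

(** The zero trade is valid, so the best trade does not hurt the active agent; the idle agent keeps
    her holding. *)
Lemma taking_turns_utility_le i n : U i n <= U i n.+1.
Proof.
have [Xms _ _] := taking_turns_feasible n.
case: XP => _ XS; have [h [[hv hmax] Xn]] := XS n.
rewrite /U Xn; move: (active first n) hv hmax => j hv hmax.
have [->|->] := agent_other j i; last by rewrite holding_execute_other.
rewrite holding_execute; have := hmax 0; rewrite subr0; apply.
by case: Xms => r0q rq; split; rewrite ?addr0 ?subr0.
Qed.

Lemma taking_turns_utility_nondecreasing i :
  {homo U i : n m / (n <= m)%N >-> n <= m}.
Proof.
apply: homo_leq => //; last exact: taking_turns_utility_le.
by move=> ? ? ?; exact: le_trans.
Qed.

Lemma taking_turns_box n i : box (Defs.total Sin) (holding (X n) i) /\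
  box (Defs.total Sin) (inventory (X n)).
Proof.
have [[r0q rq] <- _] := taking_turns_feasible n.
split; apply/boxP; split=> //; rewrite (totalE _ i).
  by rewrite addrAC addrK; exact: quadrantD.
by rewrite addrAC [X in X + _]addrAC subrr add0r; exact: quadrantD.
Qed.

(** A nondecreasing sequence, bounded by the utility of the total supply. *)
Lemma taking_turns_utility_cvg i : cvgn (U i).
Proof.
apply: nondecreasing_is_cvgn; first exact: taking_turns_utility_nondecreasing.
exists (utility u1 u2 i (Defs.total Sin)) => _ [n _ <-].
have [/boxP[hq Tq] _] := taking_turns_box n i.
by apply: trading_le => //; exact: utility_properties.
Qed.

Let L i := limn (U i).

Lemma utility_le_limit i n : U i n <= L i.
Proof.
apply: nondecreasing_cvgn_le; first exact: taking_turns_utility_nondecreasing.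
exact: taking_turns_utility_cvg.
Qed.

(* An idle agent's resources [A i] are those of her own previous turn, so from
   the first step on her utility is the best response whoever has just moved. *)
Lemma best_response_le_limit i n w :
  quadrant w -> phi w = phi (inventory Sin) ->
  quadrant (A i (X n.+1) - w) -> utility u1 u2 i (A i (X n.+1) - w) <= L i.
Proof.
have [_ _ Xphi] := taking_turns_feasible n.
have [_ _ XSphi] := taking_turns_feasible n.+1.
have best m h : phi (inventory (X m)) = phi (inventory Sin) ->
    utility_maximizing_trade phi u1 u2 (X m) i h ->
    X m.+1 = execute (X m) i h -> quadrant w -> phi w = phi (inventory Sin) ->
    quadrant (A i (X m) - w) -> utility u1 u2 i (A i (X m) - w) <= L i.
  move=> Xmphi [_ hmax] XmS wq phiw Awq.
  apply: le_trans (utility_le_limit i m.+1).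
  have -> : A i (X m) - w = holding (X m) i - (w - inventory (X m)).
    by rewrite opprB addrA [_ + inventory _]addrC.
  rewrite /U XmS holding_execute; apply: hmax.
  by apply: valid_trade_to; rewrite ?phiw.
case: XP => _ XS; have [h [hmax Xn]] := XS n.
have [h' [hmax' Xn']] := XS n.+1.
(* One of the consecutive steps [n] and [n.+1] is a turn of agent [i], whence the index [n.+1] in
   the statement. *)
have [ij|ij] := agent_other i (active first n); last first.
  have {}ij : active first n.+1 = i.
    by rewrite /active iterS -/(active _ _) ij; case: (i).
  by rewrite ij in hmax' Xn'; exact: best hmax' Xn'.
rewrite ij in hmax Xn.
suff -> : A i (X n.+1) = A i (X n) by exact: best hmax Xn.
by rewrite /A Xn inventory_execute holding_execute addrACA subrr addr0.
Qed.

Lemma inventory_continuous : continuous (@inventory R).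
Proof. by move=> S; apply: cvg_comp; [exact: cvg_fst|exact: cvg_fst]. Qed.

Lemma holding_continuous i : continuous (fun S : state R => holding S i).
Proof.
move=> S; case: i; last exact: cvg_snd.
by apply: cvg_comp; [exact: cvg_fst|exact: cvg_snd].
Qed.

(** * Cluster points of the play *)

Section Cluster.
Context (p : state R) (Xp : cluster (X @ \oo) p).

Lemma cluster_market_state : market_state p.
Proof.
have near_X (P : state R -> Prop) : (forall n, P (X n)) -> (X @ \oo) P.
  by move=> PX; exists 0%N => // n _; exact: PX.
split=> [|i].
  apply: (cluster_closed (A := @inventory R @^-1` quadrant)) Xp; last first.
    by apply: near_X => n; have [[]] := taking_turns_feasible n.
  apply: preimage_closed => [z _|]; first exact: inventory_continuous.
  exact: closed_quadrant.
apply: (cluster_closed (A := (fun S => holding S i) @^-1` quadrant)) Xp; last first.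
  by apply: near_X => n; have [[_ /(_ i)]] := taking_turns_feasible n.
apply: preimage_closed => [z _|]; first exact: holding_continuous.
exact: closed_quadrant.
Qed.

Lemma cluster_total : Defs.total p = Defs.total Sin.
Proof.
apply: (cluster_continuous_cvg (f := @Defs.total R)) Xp _ _.
- exact: norm_hausdorff.
- apply: cvgD; [apply: cvgD|]; [exact: inventory_continuous| |];
  exact: holding_continuous.
- apply: cvg_near_cst; apply: nearW => n.
  by have [_ -> _] := taking_turns_feasible n.
Qed.

Lemma cluster_inventory : phi (inventory p) = phi (inventory Sin).
Proof.
have [pq _] := cluster_market_state; rewrite -(clamp_id pq).
apply: (cluster_continuous_cvg (f := (phi \o clamp) \o @inventory R)) Xp _ _.
- exact: Rhausdorff.
- apply: continuous_comp; first exact: inventory_continuous.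
  exact: trading_comp_clamp_continuous.
- apply: cvg_near_cst; apply: nearW => n.
  by have [[nq _] _ <-] := taking_turns_feasible n; rewrite /= clamp_id.
Qed.

Lemma cluster_feasible : feasible phi Sin p.
Proof.
split; first exact: cluster_market_state.
- exact: cluster_total.
- exact: cluster_inventory.
Qed.

(** The value does not depend on [p]: all cluster points give the agents the same utilities, which
    is what makes them comparable. *)
Lemma cluster_utility i : utility u1 u2 i (holding p i) = L i.
Proof.
have [_ /(_ i) pq] := cluster_market_state; rewrite -(clamp_id pq).
apply: (cluster_continuous_cvg
  (f := (utility u1 u2 i \o clamp) \o (fun S => holding S i))) Xp _ _.
- exact: Rhausdorff.
- apply: continuous_comp; first exact: holding_continuous.
  exact: trading_comp_clamp_continuous (utility_properties i u1P u2P) _.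
- have UE : U i = fun n => (utility u1 u2 i \o clamp) (holding (X n) i).
    apply/funext => n; have [[_ nq] _ _] := taking_turns_feasible n.
    by rewrite /= clamp_id.
  have UL : U i @ \oo --> L i by exact: taking_turns_utility_cvg.
  by rewrite UE in UL.
Qed.

(** The level of [phi] is conserved and utilities never fall below their positive initial values, so
    no component of [p] lies on an axis. *)
Lemma cluster_interior : interior_state p.
Proof.
have [p0q pq] := cluster_market_state; case: (Sin_int) => S0q Sq.
split=> [|i].
  apply: (trading_gt0_open phiP p0q); rewrite cluster_inventory.
  exact: trading_gt0.
have uP := utility_properties i u1P u2P.
apply: (trading_gt0_open uP (pq i)); rewrite cluster_utility.
apply: lt_le_trans (utility_le_limit i 0).
by rewrite /U; case: XP => -> _; exact: trading_gt0.
Qed.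

(* A profitable reply leaves positive holdings, so it remains affordable at all
   nearby states of the play, where best_response_le_limit applies. *)
Lemma cluster_equilibrium : unilateral_equilibrium phi u1 u2 p.
Proof.
have [p0q pq] := cluster_market_state; split=> // i [h [[vq phiv hq]]].
rewrite cluster_utility.
have uP := utility_properties i u1P u2P.
set w := inventory p + h in vq phiv *.
have hw : holding p i - h = A i p - w.
  by rewrite /A /w [inventory p + holding p i]addrC addrKA.
rewrite hw in hq *; move=> Luw.
pose g S := A i S - w.
have gc : {for p, continuous g}.
  apply: cvgB; last exact: cvg_cst.
  by apply: cvgD; [exact: inventory_continuous|exact: holding_continuous].
have gq : open_quadrant (g p).
  apply: (trading_gt0_open uP hq); apply: lt_trans Luw.
  rewrite -cluster_utility; apply: trading_gt0 => //.
  by have [_] := cluster_interior.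
have ugc : {for p, continuous ((utility u1 u2 i \o clamp) \o g)}.
  by apply: continuous_comp => //; exact: trading_comp_clamp_continuous.
have near_open : \forall S \near p, open_quadrant (g S).
  by apply: gc; apply: open_nbhs_nbhs; split; [exact: open_open_quadrant|].
have near_gt : \forall S \near p, L i < (utility u1 u2 i \o clamp) (g S).
  by apply: (cvgr_gt _ ugc); rewrite /= clamp_id.
pose B S := open_quadrant (g S) -> utility u1 u2 i (g S) <= L i.
have XB : (X @ \oo) B.
  (* The initial state is skipped: the agent who does not go first need not respond optimally to
     it. *)
  exists 1%N => // -[//|n] _ gnq; apply: best_response_le_limit => //.
    by rewrite phiv cluster_inventory.
  exact: open_quadrant_quadrant.
have [S [BS [SO SL]]] := Xp XB (filterI near_open near_gt).
have := BS SO; move: SL; rewrite /= clamp_id; last exact: open_quadrant_quadrant.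
by move=> /lt_le_trans/[apply]; rewrite ltxx.
Qed.
End Cluster.
End Dynamics.
End MarketTheory.

(** * Convergence of the play and optimality of its limit *)

Theorem corollary2 (R : realType) (phi u1 u2 : R * R -> R)
    (hphi : properties_I_IV phi) (hu1 : properties_I_IV u1)
    (hu2 : properties_I_IV u2)
    (Sin : state R) (hSin : interior_state Sin) (first : agent) :
  (exists S : nat -> state R, taking_turns phi u1 u2 first Sin S) /\
  (forall S : nat -> state R, taking_turns phi u1 u2 first Sin S ->
     exists Slim : state R,
       [/\ S n @[n --> \oo] --> Slim,
           unilateral_equilibrium phi u1 u2 Slim,
           feasible_improving phi u1 u2 Sin Slim
         & pareto_optimal phi u1 u2 Slim]).
Proof.
split.
  apply: taking_turns_exists => //; case: hSin => S0q Sq.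
  by split=> [|i]; exact: open_quadrant_quadrant.
move=> X XP.
pose B := box (Defs.total Sin); pose V : set (state R) := B `*` B `*` B.
have Vc : compact V.
  by apply: compact_setX; [apply: compact_setX|]; exact: box_compact.
have XV : (X @ \oo) V.
  exists 0%N => // n _; have box_n := taking_turns_box hSin XP n.
  split; [split|]; first exact: (box_n agent1).2.
    exact: (box_n agent1).1.
  exact: (box_n agent2).1.
have [p [_ Xp]] := Vc _ _ XV.
have peq := cluster_equilibrium hphi hu1 hu2 hSin XP Xp.
have pint := cluster_interior hphi hu1 hu2 hSin XP Xp.
have [pms ptot pphi] := cluster_feasible hphi hSin XP Xp.
have putil i := cluster_utility hu1 hu2 hSin XP Xp i.
exists p; split=> //.
(* A second cluster point [q] is feasible from [p] and gives both agents the same utilities, so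
   unimprovability of [p] forces [q = p]. *)
- apply: compact_unique_cluster_cvg Vc XV _ => q Xq.
  have [qms qtot qphi] := cluster_feasible hphi hSin XP Xq.
  apply: (equilibrium_unimprovable hphi hu1 hu2 peq pint).
    by split; rewrite ?qtot ?ptot ?qphi ?pphi.
  by move=> i; rewrite putil (cluster_utility hu1 hu2 hSin XP Xq).
- split; first by [].
  move=> i; rewrite putil.
  by have := utility_le_limit hu1 hu2 hSin XP i 0; case: (XP) => ->.
(* A Pareto improvement [T] would coincide with [p], against its strict inequality. *)
- split=> // -[T [Tfeas Tle [i]]].
  by rewrite (equilibrium_unimprovable hphi hu1 hu2 peq pint Tfeas Tle) ltxx.
Qed.
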